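(* For any fixed real number $c \in (0,1]$, $$\lim_{x\to\infty} \frac{\#\{ n \le x : t_n \leq n^c \}}{x} = \lim_{x\to\infty} \frac{\#\{ n \le x : P^+(n) \leq n^c \}}{x},$$ (both limits exist and they are equal), where $n$ ranges over positive integers.
   Context: For a positive integer $n$, $t_n$ is defined as follows: if $n$ is a perfect square then $t_n=0$; otherwise $t_n$ is the least positive integer such that there are integers $1\leq j_1<\cdots<j_s=t_n$ (with $s\ge 1$) for which $n\prod_{i=1}^s(n+j_i)$ is a perfect square. $P^+(n)$ denotes the largest prime factor of $n$, with $P^+(1)=1$. *)

(* Defs.v *)
From HB Require Import structures.
From mathcomp Require Import all_boot all_order all_algebra.
From mathcomp Require Import all_classical all_reals all_analysis.

Set Implicit Arguments.
Unset Strict Implicit.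
Unset Printing Implicit Defensive.

Import Order.TTheory GRing.Theory Num.Theory.
Import numFieldNormedType.Exports.

Local Open Scope ring_scope.

(* Bounding the root by n loses nothing, since m <= m ^ 2; see perfect_squareP. *)
Definition perfect_square (n : nat) : bool := [exists m : 'I_n.+1, n == m ^ 2]%N.

Lemma perfect_squareP (n : nat) :
  reflect (exists m : nat, n = m ^ 2)%N (perfect_square n).
Proof.
apply: (iffP existsP) => [[m /eqP ->]|[m ->]]; first by exists m.
have lt_m : (m < (m ^ 2).+1)%N by case: m => // m; rewrite ltnS leq_pmulr.
by exists (Ordinal lt_m).
Qed.

(* J is the set {j_1 < ... < j_s} of integers in [1, t], with j_s = t; the two *)
(* membership conditions exclude t = 0 and force s >= 1.                       *)
Definition square_completion (n t : nat) : bool :=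
  [exists J : {set 'I_t.+1},
     [&& ord0 \notin J, ord_max \in J
       & perfect_square (n * \prod_(j in J) (n + j))]]%N.

Lemma square_completion_single (n t : nat) :
  (0 < t)%N -> perfect_square (n * (n + t))%N -> square_completion n t.
Proof.
move=> t_gt0 sq; apply/existsP; exists [set ord_max].
by rewrite !inE -val_eqE /= eq_sym -lt0n t_gt0 eqxx /= big_set1.
Qed.

(* For n > 0, n * (n + 3 n) = (2 n) ^ 2. *)
Lemma square_completion_exists (n : nat) : exists t, square_completion n t.
Proof.
case: n => [|n].
  by exists 1%N; apply: square_completion_single => //;
     apply/perfect_squareP; exists 0%N.
exists (3 * n.+1)%N; apply: square_completion_single => //.
apply/perfect_squareP; exists (2 * n.+1)%N.
by rewrite -mulSn mulnCA expnMn mulnn.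
Qed.

Definition graham_t (n : nat) : nat :=
  if perfect_square n then 0%N else ex_minn (square_completion_exists n).

(* The number of integers 1 <= n <= x satisfying P (for real x, n <= x if and *)
(* only if n <= Num.truncn x, as n >= 1).                                     *)
Definition count_upto (R : realType) (P : pred nat) (x : R) : nat :=
  (\sum_(1 <= n < (Num.truncn x).+1 | P n) 1)%N.

(* Main.v *)
Require Import Defs.
From HB Require Import structures.
From mathcomp Require Import all_boot all_order all_algebra.
From mathcomp Require Import all_classical all_reals all_analysis.
From mathcomp Require Import zify ring lra.
Import Order.TTheory GRing.Theory Num.Theory.
Import numFieldNormedType.Exports.
Local Open Scope classical_set_scope.
Local Open Scope ring_scope.

(** Let P(n) be the largest prime factor of n.  If t_n < P(n) then P(n) occurs
    in n to an even power, so P(n)^2 divides n (or n = 1); this is rare once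
    P(n) > x^c.  Conversely, in an interval of h integers consider those n with
    P(n) <= y and t_n >= h.  The products over their subsets have pairwise
    distinct exponent parities: otherwise a symmetric difference of two subsets
    has a square product, and its least element n gets t_n < h.  Hence there
    are at most y of them.  With h about (dx)^c and y = d h, only O(d x) integers
    n <= x are exceptional, and those with y < P(n) <= x^c number O_d(x / log x)
    by Mertens.

    The density of {n <= x : P(n) <= x^u} exists: by Buchstab's identity
    [x] - Psi(x, x^u) is the sum of Psi(x/p, p) over x^u < p <= x, where
    Psi(x, y) = #{n <= x : P(n) <= y} and p = (x/p)^w with w = v/(1-v) for
    p = x^v.  As the densities at w are already known and monotone in w, cutting
    [u, 1] into m equal pieces and applying Mertens on each of them leaves an
    oscillation O_u(1/m). *)

(** * Square products *)

Lemma logn_prod (I : Type) (r : seq I) (P : pred I) (F : I -> nat) (p : nat) :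
  (forall i, P i -> 0 < F i)%N ->
  logn p (\prod_(i <- r | P i) F i)%N = (\sum_(i <- r | P i) logn p (F i))%N.
Proof.
move=> F_gt0; elim: r => [|i r IHr]; first by rewrite !big_nil logn1.
rewrite !big_cons; case: ifP => // Pi.
by rewrite lognM ?IHr ?F_gt0 // prodn_cond_gt0.
Qed.

Lemma perfect_square_even_logn (n : nat) :
  (0 < n)%N -> (forall p, ~~ odd (logn p n)) -> perfect_square n.
Proof.
move=> n_gt0 even_n; apply/perfect_squareP.
exists (\prod_(0 <= p < n.+1) p ^ (logn p n)./2)%N.
rewrite -{1}(partnT n_gt0) /partn; move: (n.+1) => N.
rewrite (big_morph (fun k => k ^ 2)%N (id1 := 1%N) (op1 := muln)) //; last first.
  by move=> a b; rewrite expnMn.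
by apply: eq_bigr => p _; rewrite -expnM muln2 even_halfK.
Qed.

Lemma graham_t_min (n t : nat) : square_completion n t -> (graham_t n <= t)%N.
Proof. by rewrite /graham_t; case: ifP => // _ sq; case: ex_minnP => m _; apply. Qed.

Lemma graham_t_square (n : nat) : perfect_square n -> graham_t n = 0%N.
Proof. by rewrite /graham_t => ->. Qed.

Lemma graham_t_completion (n : nat) :
  ~~ perfect_square n -> square_completion n (graham_t n).
Proof. by rewrite /graham_t => /negbTE ->; case: ex_minnP. Qed.

(** Induction on [h] discards unselected integers at the top, because [square_completion] requires
    its largest offset to be used. If only [n] is left, it is a square and [graham_t n] is 0. *)
Lemma graham_t_le_prod_square (P : pred nat) (n h : nat) :
  P n -> perfect_square (\prod_(n <= m < (n + h).+1 | P m) m) ->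
  (graham_t n <= h)%N.
Proof.
move=> Pn; elim: h => [|h IHh] sq.
  rewrite graham_t_square //.
  by move: sq; rewrite addn0 big_ltn_cond // Pn big_geq // muln1.
case Ph: (P (n + h.+1)%N); last first.
  apply: leqW; apply: IHh; move: sq.
  by rewrite big_mkcond big_nat_recr /= ?addnS -?addnS ?Ph ?muln1 -?big_mkcond ?addnS //; lia.
apply: graham_t_min; apply/existsP.
exists [set j : 'I_h.+2 | (0 < j)%N && P (n + j)%N]%SET.
rewrite !inE /= Ph /=; move: sq; congr (perfect_square _).
rewrite big_ltn_cond ?Pn; last by lia.
congr muln; rewrite -{1}[n.+1]add0n big_addn.
rewrite (_ : ((n + h.+1).+1 - n.+1 = h.+1)%N); last by lia.
under [RHS]eq_bigl => j do rewrite inE.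
rewrite -(big_mkord (fun j => (0 < j) && P (n + j))%N (fun j => n + j)%N).
rewrite [RHS]big_ltn_cond //= (big_addn 0 _ 1) subn1 /=.
by apply: congr_big => // i; rewrite addn1 addnC addSnnS.
Qed.

(** Subsets of the selected integers are sent to the exponent parities of their products, vectors
    with [y] binary entries. Injectivity of this map gives [2 ^ #|S| <= 2 ^ y]. *)
Lemma count_smooth_large_graham_t (N h y : nat) (E : pred nat) :
  (forall m, N < m <= N + h -> E m -> max_pdiv m <= y /\ h <= graham_t m)%N ->
  (\sum_(N.+1 <= m < (N + h).+1 | E m) 1 <= y)%N.
Proof.
move=> hE.
pose v (i : nat) := (N + i.+1)%N.
pose S := [set i : 'I_h | E (v i)]%SET.
have -> : (\sum_(N.+1 <= m < (N + h).+1 | E m) 1 = #|S|)%N.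
  rewrite -sum1dep_card -[N.+1]add0n big_addn.
  rewrite (_ : ((N + h).+1 - N.+1 = h)%N); last by lia.
  by rewrite big_mkord; apply: eq_bigl => i; rewrite addnS addnC /v addnS.
(* The coordinates are the integers from 1 to [y]; at one that is not prime [logn] vanishes and the
   entry is constant. *)
pose f (T : {set 'I_h}) := [ffun p : 'I_y => odd (\sum_(i in T) logn p.+1 (v i))].
rewrite -(leq_exp2l (m := 2)) // -card_powerset.
rewrite (_ : (2 ^ y = #|{ffun 'I_y -> bool}|)%N); last first.
  by rewrite card_ffun card_bool card_ord.
suff f_inj : {in powerset S &, injective f} by exact: leq_card_in f_inj.
move=> T T'; rewrite !inE => TS T'S fTT'; apply/eqP; apply/negPn/negP => neqT.
pose D := ((T :\: T') :|: (T' :\: T))%SET.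
have DS i : i \in D -> E (v i).
  rewrite !inE => /orP[/andP[_ iT]|/andP[_ iT]].
    by have := fintype.subsetP TS _ iT; rewrite inE.
  by have := fintype.subsetP T'S _ iT; rewrite inE.
have [i0 i0D] : exists i, i \in D.
  apply/finset.set0Pn; apply: contraNneq neqT => D0.
  move/eqP: D0; rewrite finset.setU_eq0 !finset.setD_eq0 => /andP[s1 s2].
  by rewrite finset.eqEsubset s1 s2.
(* The least element [v i] of the symmetric difference starts a square product inside the interval,
   which ends at [v i + (h - i.+1)]. This forces [graham_t (v i) < h], against the hypothesis. *)
case: (arg_minnP (fun i : 'I_h => val i) i0D) => i iD imin; change (is_true (i \in D)) in iD.
have vE (j : 'I_h) : (N < v j <= N + h)%N.
  by rewrite /v; have := ltn_ord j; lia.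
have [_ hi] := hE _ (vE i) (DS _ iD).
have i_lt := ltn_ord i.
suff : (graham_t (v i) <= h - i.+1)%N by lia.
pose P m := [exists j in D, v j == m].
apply: (@graham_t_le_prod_square P).
  by apply/existsP; exists i; rewrite iD /=.
have -> : (\prod_(v i <= m < (v i + (h - i.+1)).+1 | P m) m
           = \prod_(j in D) v j)%N.
  transitivity (\prod_(N.+1 <= m < (N + h).+1 | P m) m)%N.
    rewrite (_ : (v i + (h - i.+1)).+1 = (N + h).+1)%N; last by rewrite /v; lia.
    rewrite [RHS](@big_cat_nat _ _ _ (v i)) /=; [| by rewrite /v; lia..].
    rewrite [X in (_ = X * _)%N]big_nat_cond [X in (_ = X * _)%N]big1 ?mul1n //.
    move=> m /andP[/andP[_ m_lt] /existsP[j /andP[jD /eqP vj]]].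
    by have : (i <= j)%N := imin _ jD; move: m_lt; rewrite -vj /v; lia.
  rewrite -[N.+1]add0n big_addn.
  rewrite (_ : ((N + h).+1 - N.+1 = h)%N); last by lia.
  rewrite big_mkord; apply: eq_big => [j|j _]; last by rewrite /v; lia.
  apply/existsP/idP => [[k /andP[kD /eqP]]|jD]; last first.
    by exists j; rewrite jD /v; apply/eqP; lia.
  by rewrite /v => kj; rewrite -(_ : k = j) //; apply/val_inj => /=; lia.
have v_gt0 j : (0 < v j)%N by rewrite /v addnS.
apply: perfect_square_even_logn => [|p]; first by rewrite prodn_cond_gt0.
rewrite logn_prod //.
case: p => [|p]; first by rewrite big1.
have [p_ge|p_lt] := leqP y p.
  rewrite big1 // => j jD; apply/eqP; rewrite -leqn0 leqNgt logn_gt0.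
  apply/negP => /max_pdiv_max.
  by have [+ _] := hE _ (vE j) (DS _ jD); lia.
have : f T (Ordinal p_lt) = f T' (Ordinal p_lt) by rewrite fTT'.
(* The common part of [T] and [T'] cancels, so the two halves of [D] have equal parity at [p.+1]. *)
rewrite !ffunE /= (big_setID T') /= [in RHS](big_setID T) /= finset.setIC !oddD.
move=> /addbI e; rewrite (big_setID T) /=.
rewrite (_ : D :&: T = T :\: T')%SET; last first.
  by apply/finset.setP => j; rewrite !inE; case: (j \in T); case: (j \in T').
rewrite (_ : D :\: T = T' :\: T)%SET; last first.
  by apply/finset.setP => j; rewrite !inE; case: (j \in T); case: (j \in T').
by rewrite oddD e addbb.
Qed.

(** The offsets are at most [graham_t n], hence smaller than the largest prime [p] of [n], so [p]
    divides no [n + j]. Its exponent in the square product is its exponent in [n], which is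
    therefore even and positive. *)
Lemma graham_t_lt_max_pdiv (n : nat) :
  (0 < n)%N -> (graham_t n < max_pdiv n)%N ->
  (n == 1)%N || (max_pdiv n ^ 2 %| n)%N.
Proof.
move=> n_gt0 t_lt; have [->//|n_neq1 /=] := eqVneq n 1%N.
have p_pr : prime (max_pdiv n) by apply: max_pdiv_prime; lia.
set p := max_pdiv n in t_lt p_pr *.
have p_dvd : (p %| n)%N by exact: max_pdiv_dvd.
rewrite pfactor_dvdn //.
have logp_gt0 : (0 < logn p n)%N by rewrite -(pfactor_dvdn 1).
suff : ~~ odd (logn p n) by lia.
have even_sq m : perfect_square m -> ~~ odd (logn p m).
  by case/perfect_squareP => k ->; rewrite lognX oddM.
have [/even_sq//|/graham_t_completion] := boolP (perfect_square n).
case/existsP => J /and3P[J0 _ /even_sq].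
have np_gt0 (j : nat) : (0 < n + j)%N by lia.
rewrite lognM ?prodn_cond_gt0 // logn_prod // big1 ?addn0 // => j jJ.
apply/eqP; rewrite -leqn0 leqNgt -(pfactor_dvdn 1) // expn1.
rewrite dvdn_addr //; apply/negP => /dvdn_leq.
have j_gt0 : (0 < j)%N.
  by rewrite lt0n; apply: contraNneq J0 => j0; rewrite (_ : ord0 = j) //; apply: val_inj.
by move=> /(_ j_gt0); have := ltn_ord j; lia.
Qed.

(** * Mertens' first theorem *)

Lemma prod_primes_dvdn (a b k : nat) :
  (forall p, a <= p < b -> prime p -> p %| k)%N ->
  (\prod_(a <= p < b | prime p) p %| k)%N.
Proof.
elim: b => [|b IHb] hk; first by rewrite big_geq // dvd1n.
have [a_gt|a_le] := ltnP b a; first by rewrite big_geq // dvd1n.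
have IH : (\prod_(a <= p < b | prime p) p %| k)%N.
  by apply: IHb => p hp; apply: hk; lia.
rewrite big_mkcond big_nat_recr //= -big_mkcond /=.
case: ifP => [b_pr|_]; last by rewrite muln1.
rewrite Gauss_dvd ?IH ?hk ?leqnn ?andbT //.
rewrite coprime_sym prime_coprime // -[X in (X %| _)%N]expn1 pfactor_dvdn //.
  rewrite logn_prod; last by move=> p /prime_gt0.
  rewrite big_nat_cond big1 // => p /andP[/andP[_ p_lt] p_pr].
  by rewrite logn_prime //; case: eqP p_lt => // ->; rewrite ltnn.
by rewrite prodn_cond_gt0 // => p /prime_gt0.
Qed.

Lemma logn_fact_eq0 (p n : nat) : (n < p)%N -> logn p n`! = 0%N.
Proof.
have [p_pr|/negbTE np] := boolP (prime p); last by rewrite lognE np.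
move=> n_lt; rewrite logn_fact // big_nat_cond big1 // => i /andP[/andP[i_gt0 _] _].
rewrite divn_small // (leq_trans n_lt) // -[X in (X <= _)%N]expn1.
by rewrite leq_exp2l // prime_gt1.
Qed.

(** The coefficients at [m] and [m + 1] are two equal terms of a binomial sum with value
    [2 ^ (2 m + 1)]. *)
Lemma bin_middle_le (m : nat) : ('C(m.*2.+1, m) <= 4 ^ m)%N.
Proof.
have sum2 : (\sum_(i < m.*2.+2) 'C(m.*2.+1, i) = 2 ^ m.*2.+1)%N.
  rewrite -[2%N]/(1 + 1)%N expnDn; apply: eq_bigr => i _.
  by rewrite !exp1n !muln1.
have m_lt : (m < m.*2.+2)%N by lia.
have m1_lt : (m.+1 < m.*2.+2)%N by lia.
move: sum2; rewrite (bigD1 (Ordinal m_lt)) //= (bigD1 (Ordinal m1_lt)) /=; last first.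
  by rewrite -val_eqE /=; lia.
have -> : ('C(m.*2.+1, m.+1) = 'C(m.*2.+1, m))%N.
  by rewrite -bin_sub; [congr ('C(_, _)); lia | lia].
rewrite expnS -[X in (2 ^ X)%N]mul2n expnM -[(2 ^ 2)%N]/4%N.
by move: (bigop.body _ _ _) ('C(_, _)) (4 ^ m)%N => s b q; lia.
Qed.

(* For n = 2 m + 1 the primes in (m + 1, n] divide 'C(n, m) <= 4 ^ m. *)
Lemma primorial_le (n : nat) : (\prod_(0 <= p < n.+1 | prime p) p <= 4 ^ n)%N.
Proof.
elim/ltn_ind: n => n IHn.
have [n_le2|n_gt2] := leqP n 2.
  by move: n n_le2 {IHn} => [|[|[|]]] // _; rewrite unlock.
have [n_odd|n_even] := boolP (odd n); last first.
  rewrite big_mkcond big_nat_recr //= -big_mkcond /=.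
  case: ifP => [n_pr|_]; last first.
    rewrite muln1; case: n n_gt2 IHn {n_even} => // n n_gt2 IHn.
    by apply: (leq_trans (IHn n _)) => //; rewrite leq_exp2l.
  by case: (even_prime n_pr) n_even n_gt2 => [->|->].
have [m nE] : exists m, n = m.*2.+1 by exists n./2; lia.
have m_gt0 : (0 < m)%N by lia.
rewrite (@big_cat_nat _ _ _ m.+2) /=; [|lia|lia].
apply: (@leq_trans (4 ^ m.+1 * 4 ^ m)); last by rewrite -expnD leq_exp2l //; lia.
apply: leq_mul; first by apply: IHn; lia.
apply: leq_trans (bin_middle_le m); apply: dvdn_leq.
  by rewrite bin_gt0; lia.
apply: prod_primes_dvdn => p /andP[p_gt p_le] p_pr.
(* [p] divides [n!] and exceeds [m + 1 = n - m], so it divides neither [m!] nor [(n - m)!] and must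
   divide the binomial coefficient. *)
have : (p %| n`!)%N by apply: dvdn_fact; rewrite prime_gt0.
rewrite nE -(@bin_fact _ m); last by lia.
rewrite Gauss_dvdl // prime_coprime // -[X in (X %| _)%N]expn1 pfactor_dvdn //; last first.
  by rewrite muln_gt0 !fact_gt0.
rewrite lognM ?fact_gt0 //.
by rewrite !logn_fact_eq0 //; lia.
Qed.

Lemma ln_prod (R : realType) (I : Type) (r : seq I) (P : pred I) (F : I -> nat) :
  (forall i, P i -> 0 < F i)%N ->
  ln ((\prod_(i <- r | P i) F i)%N%:R) = \sum_(i <- r | P i) ln (F i)%:R :> R.
Proof.
move=> F_gt0; elim: r => [|i r IHr]; first by rewrite !big_nil ln1.
rewrite !big_cons; case: ifP => // Pi.
by rewrite natrM lnM ?IHr // posrE ltr0n ?F_gt0 // prodn_cond_gt0.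
Qed.

Lemma theta_le (R : realType) (n : nat) :
  \sum_(0 <= p < n.+1 | prime p) ln p%:R <= n%:R * 4 :> R.
Proof.
rewrite -ln_prod => [|p /prime_gt0 //].
have prod_gt0 : (0 < \prod_(0 <= p < n.+1 | prime p) p)%N.
  by rewrite prodn_cond_gt0 // => p /prime_gt0.
apply: (@le_trans _ _ (ln ((4 ^ n)%N%:R))).
  by rewrite ler_ln ?posrE ?ltr0n ?expn_gt0 // ler_nat primorial_le.
rewrite natrX lnXn // -[X in X <= _]mulr_natl ler_wpM2l //.
by apply/ltW/ln_sublinear.
Qed.

Lemma ln_fact_le (R : realType) (n : nat) : ln n`!%:R <= n%:R * ln n%:R :> R.
Proof.
case: n => [|n]; first by rewrite ln1 mul0r.
rewrite mulr_natl -lnXn // ler_ln ?posrE ?ltr0n ?fact_gt0 ?exprn_gt0 //.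
rewrite -natrX ler_nat; move: (n.+1) => m.
rewrite -ffactnn -[X in (_ <= _ ^ X)%N]/m.
elim: {2 4}m => [|k IHk]; first by rewrite ffactn0.
by rewrite ffactnSr expnSr leq_mul // leq_subr.
Qed.

Lemma ln_succ_le (R : realType) (n : nat) :
  (0 < n)%N -> ln n.+1%:R <= ln n%:R + n%:R^-1 :> R.
Proof.
move=> n_gt0; have n_pos : 0 < n%:R :> R by rewrite ltr0n.
have -> : n.+1%:R = n%:R * (1 + n%:R^-1) :> R.
  by rewrite mulrDr mulfV ?gt_eqF // mulr1 -natr1.
have iv_gt0 : 0 < n%:R^-1 :> R by rewrite invr_gt0.
rewrite lnM ?posrE ?addr_gt0 // lerD2l.
by apply: le_ln1Dx; rewrite (lt_trans _ iv_gt0) // ltrN10.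
Qed.

Lemma ln_fact_ge (R : realType) (n : nat) :
  n%:R * ln n%:R - n%:R <= ln n`!%:R :> R.
Proof.
elim: n => [|n IHn]; first by rewrite mul0r subr0 ln1.
have [->|n_gt0] := posnP n; first by rewrite !ln1 mulr0 sub0r oppr_le0.
have n_pos : 0 < n%:R :> R by rewrite ltr0n.
rewrite factS natrM lnM ?posrE ?ltr0n ?fact_gt0 //.
have := @ln_succ_le R n n_gt0; move: IHn; rewrite -natr1.
set a := ln _; set b := ln (_ + 1); set f := ln _ => IH hb.
have : n%:R * b <= n%:R * a + 1.
  by have := ler_wpM2l (ltW n_pos) hb; rewrite mulrDr mulfV ?gt_eqF.
lra.
Qed.

Lemma ln_fact_legendre (R : realType) (n : nat) :
  ln n`!%:R = \sum_(0 <= p < n.+1 | prime p) (logn p n`!)%:R * ln p%:R :> R.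
Proof.
(* The factorization of [n!] runs up to [n!]; it is first extended to [n + n!] so that it can be cut
   at [n] in every case. *)
rewrite -{1}(partnT (fact_gt0 n)) (@widen_partn (n + n`!)); last by lia.
rewrite (@big_cat_nat _ _ _ n.+1) /=; [|lia|lia].
rewrite [X in (_ * X)%N]big_nat_cond [X in (_ * X)%N]big1 ?muln1; last first.
  by move=> p /andP[/andP[p_gt _] _]; rewrite logn_fact_eq0.
rewrite ln_prod; last first.
  move=> [|p] _; last by rewrite expn_gt0.
  by rewrite (_ : logn 0 _ = 0%N) // lognE.
rewrite [RHS]big_mkcond /=; apply: eq_bigr => p _.
case: ifP => [p_pr|np]; last by rewrite lognE np expn0 ln1.
by rewrite natrX lnXn ?ltr0n ?prime_gt0 // mulr_natl.
Qed.

Lemma logn_fact_ge (R : realType) (n p : nat) :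
  prime p -> n%:R / p%:R - 1 <= (logn p n`!)%:R :> R.
Proof.
move=> p_pr; have p_pos : 0 < p%:R :> R by rewrite ltr0n prime_gt0.
have [->|n_gt0] := posnP n.
  by rewrite mul0r sub0r (le_trans _ (ler0n _ _)) // oppr_le0.
apply: (@le_trans _ _ (n %/ p)%:R).
  rewrite lerBlDr natr1 ler_pdivrMr // -natrM ler_nat.
  by rewrite ltnW // ltn_ceil // prime_gt0.
by rewrite ler_nat logn_fact // big_ltn // expn1 leq_addr.
Qed.

(** Legendre's sum of the [n %/ p ^ k] is bounded by a geometric series with value [n / (p - 1)];
    the induction carries its exact partial sums. *)
Lemma logn_fact_le (R : realType) (n p : nat) :
  prime p -> (logn p n`!)%:R <= n%:R / (p%:R - 1) :> R.
Proof.
move=> p_pr; have p_gt1 : 1 < p%:R :> R by rewrite ltr1n prime_gt1.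
have p_pos : 0 < p%:R :> R by lra.
rewrite logn_fact // natr_sum.
suff : forall m, \sum_(1 <= k < m.+1) (n %/ p ^ k)%:R
       <= n%:R * ((p%:R - 1)^-1 * (1 - p%:R ^- m)) :> R.
  move=> /(_ n) /le_trans; apply; rewrite ler_wpM2l //.
  rewrite ler_piMr ?invr_ge0 ?subr_ge0 ?ltW // gtrBl invr_gt0 exprn_gt0 //.
elim=> [|m IHm].
  by rewrite big_geq // expr0 invr1 subrr !mulr0.
rewrite big_nat_recr //=.
have : (n %/ p ^ m.+1)%:R <= n%:R * p%:R ^- m.+1 :> R.
  by rewrite ler_pdivlMr ?exprn_gt0 // -natrX -natrM ler_nat leq_trunc_div.
move: IHm; rewrite exprSr invfM.
have q_pos : 0 < p%:R ^- m :> R by rewrite invr_gt0 exprn_gt0.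
set q := p%:R ^- m => IHm h; apply: (le_trans (lerD IHm h)).
rewrite -mulrDr ler_wpM2l // le_eqVlt; apply/orP; left; apply/eqP.
by field; rewrite gt_eqF //= gt_eqF //; lra.
Qed.

(* The terms are dominated by the increments of - (ln n + 2) / n. *)
Lemma sum_ln_div_sq_le (R : realType) (n : nat) :
  \sum_(0 <= p < n.+1 | prime p) ln p%:R / (p%:R * (p%:R - 1)) <= 2 :> R.
Proof.
case: n => [|n]; first by rewrite big_mkcond big_nat1.
suff : \sum_(0 <= p < n.+2 | prime p) ln p%:R / (p%:R * (p%:R - 1))
       <= 2 - (ln n.+1%:R + 2) / n.+1%:R :> R.
  move=> /le_trans; apply; rewrite gerBl divr_ge0 // addr_ge0 // ln_ge0 //.
  by rewrite ler1n.
elim: n => [|n IHn].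
  by rewrite ln1 add0r divr1 subrr big_mkcond /= 2?big_nat_recr //= big_geq //.
rewrite big_mkcond big_nat_recr //= -big_mkcond /=.
apply: le_trans (_ : 2 - (ln n.+1%:R + 2) / n.+1%:R +
    ln n.+2%:R / (n.+2%:R * (n.+2%:R - 1)) <= _).
  apply: lerD => //; case: ifP => // _.
  rewrite divr_ge0 ?ln_ge0 ?ler1n // mulr_ge0 // subr_ge0 ler1n //.
have := @ln_succ_le R n.+1 isT.
have : 0 <= ln n.+1%:R :> R by rewrite ln_ge0 // ler1n.
have -> : n.+2%:R = n.+1%:R + 1 :> R by rewrite natr1.
have : 1 <= n.+1%:R :> R by rewrite ler1n.
set a := ln n.+1%:R; set b := ln _; set x := n.+1%:R => x1 a0 hb; clearbody a b x.
have x0 : 0 < x by lra.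
have xb : x * b <= x * a + 1.
  by have := ler_wpM2l (ltW x0) hb; rewrite mulrDr mulfV ?gt_eqF.
rewrite -subr_ge0.
have -> : 2 - (b + 2) / (x + 1) - (2 - (a + 2) / x + b / ((x + 1) * (x + 1 - 1)))
   = ((x + 1) * (a + 2) - x * (b + 2) - b) / (x * (x + 1)).
  by field; rewrite !gt_eqF //; lra.
rewrite divr_ge0 //; last by nra.
have ix : x^-1 <= 1 by rewrite invf_le1.
lra.
Qed.

(** By Legendre the sum of the [logn p n!] times [ln p] is [ln n!], which lies between [n ln n - n]
    and [n ln n]. Replacing [logn p n!] by [n / p] costs at most [4 n] on one side, by [theta_le],
    and [2 n] on the other, by [sum_ln_div_sq_le]. *)
Lemma mertens_nat (R : realType) (n : nat) :
  (0 < n)%N ->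
  `|\sum_(0 <= p < n.+1 | prime p) ln p%:R / p%:R - ln n%:R| <= 4 :> R.
Proof.
move=> n_gt0; have n_pos : 0 < n%:R :> R by rewrite ltr0n.
have ln_ge0 p : prime p -> 0 <= ln p%:R :> R.
  by move=> p_pr; rewrite ln_ge0 // ler1n prime_gt0.
set M := \sum_(_ <= _ < _ | _) _.
have up : n%:R * M - n%:R * 4 <= n%:R * ln n%:R.
  apply: le_trans (@ln_fact_le R n); rewrite ln_fact_legendre.
  apply: le_trans (lerB (lexx _) (@theta_le R n)) _.
  rewrite mulr_sumr -sumrB; apply: ler_sum => p p_pr.
  apply: le_trans (_ : (n%:R / p%:R - 1) * ln p%:R <= _).
    by rewrite mulrBl mul1r lerD2r mulrA mulrAC.
  by rewrite ler_wpM2r ?ln_ge0 // logn_fact_ge.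
have low : n%:R * ln n%:R - n%:R <= n%:R * M + n%:R * 2.
  apply: le_trans (@ln_fact_ge R n) _; rewrite ln_fact_legendre.
  apply: (@le_trans _ _ (n%:R * M + n%:R *
      \sum_(0 <= p < n.+1 | prime p) ln p%:R / (p%:R * (p%:R - 1)))); last first.
    by rewrite lerD2l ler_pM2l // sum_ln_div_sq_le.
  rewrite !mulr_sumr -big_split /=; apply: ler_sum => p p_pr.
  apply: le_trans (ler_wpM2r (ln_ge0 _ p_pr) (@logn_fact_le R n p p_pr)) _.
  have p_gt1 : 1 < p%:R :> R by rewrite ltr1n prime_gt1.
  rewrite le_eqVlt; apply/orP; left; apply/eqP.
  by field; rewrite !gt_eqF //; lra.
have := ler_norml (M - ln n%:R) 4; move=> ->; apply/andP; split.
  rewrite -(ler_pM2l n_pos); lra.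
rewrite -(ler_pM2l n_pos); lra.
Qed.

(** * Sums over the primes in an interval (y, z] *)

Definition prime_sum (R : realType) (F : nat -> R) (y z : R) : R :=
  \sum_((Num.truncn y).+1 <= p < (Num.truncn z).+1 | prime p) F p.

Lemma prime_sum_le (R : realType) (F G : nat -> R) (y z : R) :
  0 <= y -> 0 <= z ->
  (forall p, prime p -> y < p%:R <= z -> F p <= G p) ->
  prime_sum R F y z <= prime_sum R G y z.
Proof.
move=> y_ge0 z_ge0 FG; rewrite /prime_sum big_nat_cond [leRHS]big_nat_cond.
apply: ler_sum => p /andP[/andP[p_gt p_le] p_pr]; apply: FG => //.
by rewrite -truncn_lt_nat // p_gt -truncn_ge_nat.
Qed.

Lemma prime_sum_cat (R : realType) (F : nat -> R) (y w z : R) :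
  y <= w -> w <= z -> prime_sum R F y z = prime_sum R F y w + prime_sum R F w z.
Proof.
by move=> yw wz; rewrite /prime_sum -big_cat_nat //= ltnS le_truncn.
Qed.

Lemma mulr_prime_sum (R : realType) (F : nat -> R) (a y z : R) :
  a * prime_sum R F y z = prime_sum R (fun p => a * F p) y z.
Proof. exact: mulr_sumr. Qed.

Lemma ln_truncn (R : realType) (x : R) :
  1 <= x -> ln (Num.truncn x)%:R <= ln x <= ln (Num.truncn x)%:R + 1.
Proof.
move=> x_ge1; have x_ge0 : 0 <= x by lra.
have n_gt0 : (0 < Num.truncn x)%N by rewrite truncn_gt0.
have /andP[le_x x_lt] := truncn_itv x_ge0.
apply/andP; split; first by rewrite ler_ln ?posrE ?ltr0n //; lra.
apply: (@le_trans _ _ (ln (Num.truncn x).+1%:R)).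
  by rewrite ler_ln ?posrE ?ltr0n ?(ltW x_lt) //; lra.
apply: le_trans (@ln_succ_le R _ n_gt0) _.
by rewrite lerD2l invf_le1 ?ltr0n // ler1n.
Qed.

(** Mertens is subtracted at the two endpoints: twice the error 4, and at most 1 for rounding at
    each end. *)
Lemma mertens_range (R : realType) (y z : R) :
  1 <= y -> y <= z ->
  `|prime_sum R (fun p => ln p%:R / p%:R) y z - (ln z - ln y)| <= 10.
Proof.
move=> y_ge1 yz; have z_ge1 : 1 <= z by lra.
have y_gt0 : (0 < Num.truncn y)%N by rewrite truncn_gt0.
have z_gt0 : (0 < Num.truncn z)%N by rewrite truncn_gt0.
have := @mertens_nat R _ z_gt0; have := @mertens_nat R _ y_gt0.
rewrite (@big_cat_nat _ _ _ (Num.truncn y).+1 0 (Num.truncn z).+1) //=; last first.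
  by rewrite ltnS le_truncn.
rewrite -/(prime_sum R (fun p => ln p%:R / p%:R) y z).
have /andP[] := ln_truncn R _ z_ge1; have /andP[] := ln_truncn R _ y_ge1.
rewrite !ler_norml => ? ? ? ? /andP[? ?] /andP[? ?].
by apply/andP; split; lra.
Qed.

(* On (y, z] the weight 1 / p lies between ln p / (p ln z) and ln p / (p ln y). *)
Lemma prime_sum_upper (R : realType) (F : nat -> R) (C y z : R) :
  0 <= C -> 1 < y -> y <= z ->
  (forall p, prime p -> y < p%:R <= z -> F p <= C / p%:R) ->
  prime_sum R F y z <= C * ((ln z - ln y + 10) / ln y).
Proof.
move=> C0 y1 yz hF; have lny : 0 < ln y by rewrite ln_gt0.
apply: le_trans (_ : prime_sum R (fun p => C / ln y * (ln p%:R / p%:R)) y z <= _).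
  apply: prime_sum_le => [||p p_pr pyz]; [lra|lra|].
  apply: le_trans (hF _ p_pr pyz) _.
  have p_pos : 0 < p%:R :> R by rewrite ltr0n prime_gt0.
  rewrite -mulrA ler_wpM2l // mulrA ler_peMl ?invr_ge0 ?(ltW p_pos) // mulrC.
  rewrite ler_pdivlMr // mul1r ler_ln ?posrE //; lra.
rewrite -mulr_prime_sum -mulrA ler_wpM2l // mulrC ler_wpM2r ?invr_ge0 ?(ltW lny) //.
have := @mertens_range R y z (ltW y1) yz.
by rewrite ler_norml => /andP[_]; rewrite lerBlDl.
Qed.

Lemma prime_sum_lower (R : realType) (F : nat -> R) (C y z : R) :
  0 <= C -> 1 < y -> y <= z ->
  (forall p, prime p -> y < p%:R <= z -> C / p%:R <= F p) ->
  C * ((ln z - ln y - 10) / ln z) <= prime_sum R F y z.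
Proof.
move=> C0 y1 yz hF; have lnz : 0 < ln z by rewrite ln_gt0 //; lra.
apply: (@le_trans _ _ (prime_sum R (fun p => C / ln z * (ln p%:R / p%:R)) y z)); last first.
  apply: prime_sum_le => [||p p_pr pyz]; [lra|lra|].
  apply: le_trans _ (hF _ p_pr pyz).
  have p_pos : 0 < p%:R :> R by rewrite ltr0n prime_gt0.
  rewrite -mulrA ler_wpM2l // mulrA ler_piMl ?invr_ge0 ?(ltW p_pos) // mulrC.
  rewrite ler_pdivrMr // mul1r ler_ln ?posrE //; lra.
rewrite -mulr_prime_sum -mulrA ler_wpM2l // mulrC ler_wpM2l ?invr_ge0 ?(ltW lnz) //.
have := @mertens_range R y z (ltW y1) yz.
by rewrite ler_norml => /andP[+ _]; lra.
Qed.

(** * Buchstab's identity *)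

Lemma max_pdiv_eq (n p : nat) :
  (0 < n)%N -> prime p ->
  (max_pdiv n == p) = (p %| n)%N && (max_pdiv (n %/ p) <= p)%N.
Proof.
move=> n_gt0 p_pr; apply/eqP/andP => [<-|[p_dvd le_p]].
  rewrite max_pdiv_dvd; split=> //; set q := max_pdiv n.
  have q_dvd : (q %| n)%N := max_pdiv_dvd n.
  have [m_le1|m_gt1] := leqP (n %/ q) 1.
    apply: leq_trans (max_pdiv_gt0 n); case: (n %/ q)%N m_le1 => [|[|]] //.
  apply: max_pdiv_max; rewrite mem_primes max_pdiv_prime // n_gt0 /=.
  by apply: dvdn_trans (max_pdiv_dvd _) _; rewrite -{2}(divnK q_dvd) dvdn_mulr.
have n_gt1 : (1 < n)%N by apply: leq_trans (prime_gt1 p_pr) (dvdn_leq n_gt0 p_dvd).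
apply/eqP; rewrite eqn_leq andbC max_pdiv_max ?mem_primes ?p_pr ?n_gt0 //=.
have q_pr := max_pdiv_prime n_gt1.
have := max_pdiv_dvd n; rewrite -{2}(divnK p_dvd) Euclid_dvdM //.
case/orP => [q_dvd|]; last by rewrite dvdn_prime2 // => /eqP ->.
apply: leq_trans le_p; apply: max_pdiv_max; rewrite mem_primes q_pr q_dvd andbT.
by rewrite divn_gt0 ?prime_gt0 // dvdn_leq.
Qed.

Lemma sum_multiples (Q : pred nat) (p n : nat) :
  (0 < p)%N ->
  (\sum_(1 <= m < n.+1 | (p %| m) && Q (m %/ p)) 1 =
   \sum_(1 <= m < (n %/ p).+1 | Q m) 1)%N.
Proof.
move=> p_gt0; elim: n => [|n IHn]; first by rewrite div0n !big_geq.
rewrite big_mkcond big_nat_recr //= -big_mkcond IHn divnS //.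
have [p_dvd|_] /= := boolP (p %| n.+1)%N; last by rewrite addn0.
by rewrite add1n [in RHS]big_mkcond [in RHS]big_nat_recr //= -big_mkcond.
Qed.

Lemma truncn_div_nat (R : realType) (x : R) (p : nat) :
  0 <= x -> (0 < p)%N -> Num.truncn (x / p%:R) = (Num.truncn x %/ p)%N.
Proof.
move=> x_ge0 p_gt0; have p_pos : 0 < p%:R :> R by rewrite ltr0n.
have /andP[le_x x_lt] := truncn_itv x_ge0.
apply: truncn_def; rewrite ler_pdivlMr // ltr_pdivrMr // -!natrM.
rewrite (le_trans _ le_x) ?ler_nat ?leq_trunc_div //=.
by apply: lt_le_trans x_lt _; rewrite ler_nat ltn_ceil.
Qed.

Definition smooth_count (R : realType) (x y : R) : R :=
  (count_upto (fun n => (max_pdiv n)%:R <= y) x)%:R.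

(** The integers counted on the left are sorted by their largest prime factor [p]. By [max_pdiv_eq],
    division by [p] turns the class of [p] into the integers up to [x / p] without prime factors
    above [p]. *)
Lemma buchstab (R : realType) (x y z : R) :
  0 <= x -> 1 <= y -> y <= z ->
  smooth_count R x z - smooth_count R x y =
  prime_sum R (fun p => smooth_count R (x / p%:R) p%:R) y z.
Proof.
move=> x_ge0 y_ge1 yz; rewrite /smooth_count /prime_sum -natr_sum.
have y_ge0 : 0 <= y by lra.
have z_ge0 : 0 <= z by lra.
set Y := Num.truncn y; set Z := Num.truncn z; set N := Num.truncn x.
have Y_gt0 : (0 < Y)%N by rewrite truncn_gt0.
have YZ : (Y <= Z)%N by apply: le_truncn.
apply/eqP; rewrite subr_eq -natrD eqr_nat; apply/eqP; rewrite /count_upto -/N.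
have cntE (w : R) : 0 <= w -> (\sum_(1 <= n < N.+1 | ((max_pdiv n)%:R <= w)%R) 1 =
    \sum_(1 <= n < N.+1) (max_pdiv n <= Num.truncn w))%N.
  by move=> w0; rewrite big_mkcond; apply: eq_bigr => n _; rewrite truncn_ge_nat //; case: ifP.
rewrite !cntE // -/Y -/Z.
transitivity (\sum_(1 <= n < N.+1)
   ((\sum_(Y.+1 <= p < Z.+1 | prime p) (max_pdiv n == p)) + (max_pdiv n <= Y)))%N.
  apply: eq_big_nat => n /andP[n_gt0 _].
  have [P_le|P_gt] := leqP (max_pdiv n) Y.
    rewrite (leq_trans P_le YZ) big_nat_cond big1 // => p /andP[/andP[p_gt _] _].
    by case: eqP => // pE; move: P_le; rewrite pE; lia.
  (* [max_pdiv n > Y >= 1] excludes [n = 1], the one case where [max_pdiv n] is not prime. *)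
  rewrite addn0; have n_gt1 : (1 < n)%N.
    by move: n_gt0 P_gt; case: n => [|[|]] //; rewrite /max_pdiv /=; lia.
  have [P_le|P_gtZ] := leqP (max_pdiv n) Z.
    rewrite big_mkcond (bigD1_seq (max_pdiv n)) ?iota_uniq //=; last first.
      by rewrite mem_index_iota P_gt.
    rewrite max_pdiv_prime // eqxx big1 // => p /negbTE.
    by rewrite eq_sym => ->; case: ifP.
  rewrite big_nat_cond big1 // => p /andP[/andP[_ p_le] _].
  by case: eqP => // pE; move: P_gtZ; rewrite pE; lia.
rewrite big_split /= exchange_big /=; congr addn.
apply: eq_bigr => p p_pr.
rewrite truncn_div_nat ?prime_gt0 // -/N.
under [RHS]eq_bigl => m do rewrite ler_nat.
rewrite -sum_multiples ?prime_gt0 // [RHS]big_mkcond /=.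
by apply: eq_big_nat => n /andP[n_gt0 _]; rewrite max_pdiv_eq //; case: ifP.
Qed.

(** * The density of smooth numbers *)

Lemma count_upto_le (R : realType) (P : pred nat) (x : R) :
  0 <= x -> (count_upto P x)%:R <= x.
Proof.
move=> x_ge0; have /andP[+ _] := truncn_itv x_ge0; apply: le_trans.
rewrite ler_nat /count_upto big_mkcond /=.
apply: (@leq_trans (\sum_(1 <= n < (Num.truncn x).+1) 1)).
  by apply: leq_sum => n _; case: ifP.
by rewrite sum_nat_const_nat muln1 subn1.
Qed.

Lemma smooth_count_le (R : realType) (x y : R) : 0 <= x -> smooth_count R x y <= x.
Proof. exact: count_upto_le. Qed.

Lemma smooth_count_ge0 (R : realType) (x y : R) : 0 <= smooth_count R x y.
Proof. exact: ler0n. Qed.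

Lemma le_smooth_count (R : realType) (x y z : R) :
  y <= z -> smooth_count R x y <= smooth_count R x z.
Proof.
move=> yz; rewrite /smooth_count ler_nat /count_upto big_mkcond [leqRHS]big_mkcond /=.
apply: leq_sum => n _; case: ifP => // Py; case: ifP => // /negbT.
by rewrite (le_trans Py yz).
Qed.

Lemma smooth_count_full (R : realType) (x : R) :
  0 <= x -> smooth_count R x x = (Num.truncn x)%:R.
Proof.
move=> x_ge0; congr (_%:R); rewrite /count_upto big_nat_cond.
transitivity (\sum_(1 <= n < (Num.truncn x).+1) 1)%N.
  rewrite [RHS]big_nat_cond; apply: eq_bigl => n; rewrite andbT andb_idr //.
  case/andP=> n_gt0; rewrite ltnS truncn_ge_nat // => n_le.
  by apply: le_trans n_le; rewrite ler_nat max_pdiv_leq.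
by rewrite sum_nat_const_nat muln1 subn1.
Qed.

Lemma powR_gt1 (R : realType) (x a : R) : 1 < x -> 0 < a -> 1 < x `^ a.
Proof.
move=> x1 a0; have x0 : 0 <= x by lra.
by rewrite -[X in X < _](congr1 (fun f => f a) (@powR1 R)) gt0_ltr_powR ?nnegrE.
Qed.

Lemma near_pinfty_powR_gt (R : realType) (a M : R) :
  0 < a -> \forall x \near +oo, M < x `^ a.
Proof.
move=> a_gt0; pose N := Num.max M 1.
have N_gt0 : 0 < N by rewrite lt_max ltr01 orbT.
exists (N `^ a^-1); split; first exact: num_real.
move=> x x_gt; apply: le_lt_trans (_ : N < _); first by rewrite le_max lexx.
have -> : N = (N `^ a^-1) `^ a by rewrite -powRrM mulVf ?gt_eqF // powRr1 // ltW.
rewrite gt0_ltr_powR // nnegrE ?powR_ge0 //.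
by rewrite (le_trans (powR_ge0 _ _) (ltW x_gt)).
Qed.

Lemma near_pinfty_ln_gt (R : realType) (M : R) : \forall x \near +oo, M < ln x.
Proof.
exists (expR M); split; first exact: num_real.
by move=> x x_gt; rewrite -(expRK M) ltr_ln // posrE ?expR_gt0 // (lt_trans (expR_gt0 M)).
Qed.

(** Intended for [X = x / p]: primes [p <= x ^ b] satisfy [x / p >= x ^ (1 - b)], so an eventual
    property holds at [x / p] for all of them simultaneously. *)
Lemma near_pinfty_uniform_powR (R : realType) (a : R) (Q : set R) :
  0 < a -> (\forall X \near +oo, Q X) ->
  \forall x \near +oo, forall X, x `^ a <= X -> Q X.
Proof.
move=> a_gt0 [M [_ MQ]].
apply: filterS (near_pinfty_powR_gt R a M a_gt0) => x Mx X xX.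
by apply: MQ; apply: lt_le_trans xX.
Qed.

(** Its limit at infinity is the Dickman function at [1 / u], for [u > 0]; here the limit is shown
    to exist without being identified. *)
Definition smooth_density (R : realType) (u x : R) : R :=
  smooth_count R x (x `^ u) / x.

(** For [0 < a <= 1] and [b = 1] this is the proportion of integers up to [x] with a prime factor
    above [x ^ a]. *)
Definition buchstab_sum (R : realType) (x a b : R) : R :=
  prime_sum R (fun p => smooth_count R (x / p%:R) p%:R / x) (x `^ a) (x `^ b).

Lemma near_pinfty_div_ln_le (R : realType) (C k : R) :
  0 <= C -> 0 < k -> \forall x \near +oo, C / ln x <= k.
Proof.
move=> C0 k0; apply: filterS (near_pinfty_ln_gt R (C / k)) => x.
rewrite ltr_pdivrMr // => h.
have lnx : 0 < ln x by rewrite -(pmulr_lgt0 _ k0); apply: le_lt_trans h.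
by rewrite ler_pdivrMr // mulrC ltW.
Qed.

(* If p = x ^ v then p = (x / p) ^ (v / (1 - v)). *)
Lemma powR_quotient_ge (R : realType) (x a p : R) : 0 < x -> 0 < p -> 0 <= a -> a < 1 ->
  p <= x `^ a -> p <= (x / p) `^ (a / (1 - a)).
Proof.
move=> x0 p0 a0 a1 px; apply: (le_trans px).
have -> : x `^ a = (x `^ (1 - a)) `^ (a / (1 - a)).
  by rewrite -powRrM; congr (_ `^ _); field; lra.
rewrite ge0_ler_powR ?nnegrE ?powR_ge0 ?divr_ge0 ?(ltW x0) ?(ltW p0) ?subr_ge0 ?(ltW a1) //.
rewrite powRB ?(gt_eqF x0) ?implybT // powRr1 ?(ltW x0) //.
by rewrite ler_pM2l // lef_pV2 ?posrE ?powR_gt0.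
Qed.

Lemma powR_quotient_le (R : realType) (x a p : R) : 0 < x -> 0 < p -> 0 <= a -> a < 1 ->
  x `^ a <= p -> (x / p) `^ (a / (1 - a)) <= p.
Proof.
move=> x0 p0 a0 a1 px; apply: (le_trans _ px).
have -> : x `^ a = (x `^ (1 - a)) `^ (a / (1 - a)).
  by rewrite -powRrM; congr (_ `^ _); field; lra.
rewrite ge0_ler_powR ?nnegrE ?powR_ge0 ?divr_ge0 ?(ltW x0) ?(ltW p0) ?subr_ge0 ?(ltW a1) //.
rewrite powRB ?(gt_eqF x0) ?implybT // powRr1 ?(ltW x0) //.
by rewrite ler_pM2l // lef_pV2 ?posrE ?powR_gt0.
Qed.

Lemma powR_quotient_ge_base (R : realType) (x b p : R) : 0 < x -> 0 < p ->
  p <= x `^ b -> x `^ (1 - b) <= x / p.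
Proof.
move=> x0 p0 px; rewrite powRB ?(gt_eqF x0) ?implybT // powRr1 ?(ltW x0) //.
by rewrite ler_pM2l // lef_pV2 ?posrE ?powR_gt0.
Qed.

(** Any [p <= x ^ b] is at most [(x / p) ^ (b / (1 - b))], so for large [x] each term is at most
    [(d + h) / p]. Mertens bounds the sum of [1 / p] by [(b - a) / a + 10 / (a ln x)], a crude form
    of [ln (b / a)]. *)
Lemma buchstab_sum_upper (R : realType) (a b d e : R) :
  0 < a -> a <= b -> b < 1 -> 0 <= d <= 1 -> 0 < e ->
  smooth_density R (b / (1 - b)) x @[x --> +oo] --> d ->
  \forall x \near +oo, buchstab_sum R x a b <= d * ((b - a) / a) + e.
Proof.
move=> a0 ab b1 /andP[d0 d1] e0 /cvgrPdist_le cvg_d.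
(* [h] contributes [h (b - a) / a <= e / 2] since [b - a <= 1], and [k] is chosen so that
   [(1 + h) k = e / 2]. *)
pose h := e * a / 2; have h0 : 0 < h by rewrite !mulr_gt0.
pose k := e / (2 * (1 + h)).
have k0 : 0 < k by rewrite divr_gt0 // mulr_gt0 // addr_gt0.
have nearX : \forall X \near +oo, smooth_count R X (X `^ (b / (1 - b))) <= (d + h) * X.
  apply: filterS2 (nbhs_pinfty_gt (num_real 0)) (cvg_d _ h0) => X X0.
  rewrite /smooth_density ler_norml => /andP[+ _].
  by rewrite lerBrDr addrC lerBlDr -ler_pdivrMr.
have b1' : 0 < 1 - b by lra.
have := near_pinfty_div_ln_le R _ _ (ltW (divr_gt0 (ltr0n _ 10) a0)) k0.
apply: filterS3 (nbhs_pinfty_gt (num_real 1)) (near_pinfty_uniform_powR R _ _ b1' nearX) => x x1 hX.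
rewrite -mulrA -invfM => hk.
have x0 : 0 < x by lra.
have lnx : 0 < ln x by rewrite ln_gt0.
have y1 : 1 < x `^ a by apply: powR_gt1.
have yz : x `^ a <= x `^ b by rewrite ler_powR // ltW.
have dh0 : 0 <= d + h by rewrite addr_ge0 // ltW.
apply: le_trans (prime_sum_upper R _ (d + h) _ _ dh0 y1 yz _) _.
  move=> p p_pr /andP[p_gt p_le].
  have p0 : 0 < p%:R :> R by rewrite ltr0n prime_gt0.
  rewrite ler_pdivrMr // mulrAC -mulrA.
  apply: le_trans (hX _ (powR_quotient_ge_base R _ _ _ x0 p0 p_le)).
  by apply/le_smooth_count/powR_quotient_ge => //; lra.
rewrite !ln_powR.
have -> : (b * ln x - a * ln x + 10) / (a * ln x) = (b - a) / a + 10 / (a * ln x).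
  by field; rewrite !gt_eqF.
apply: le_trans (_ : (d + h) * ((b - a) / a + k) <= _).
  by rewrite ler_wpM2l // lerD2l.
have hs : h * ((b - a) / a) <= e / 2.
  have -> : h * ((b - a) / a) = e / 2 * (b - a) by rewrite /h; field; rewrite gt_eqF.
  by rewrite ler_piMr //; lra.
have ke : (1 + h) * k = e / 2 by rewrite /k; field; rewrite gt_eqF //; lra.
have dk : d * k <= k by rewrite ler_piMl // ltW.
move: hs ke dk; set s := (b - a) / a; clearbody k h s; lra.
Qed.

(** Mirror image of the upper bound: [p > x ^ a] gives [p >= (x / p) ^ (a / (1 - a))], and the sum
    of [1 / p] is at least [(b - a) / b - 10 / (b ln x)]. *)
Lemma buchstab_sum_lower (R : realType) (a b d e : R) :
  0 < a -> a <= b -> b < 1 -> 0 <= d <= 1 -> 0 < e ->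
  smooth_density R (a / (1 - a)) x @[x --> +oo] --> d ->
  \forall x \near +oo, d * ((b - a) / b) - e <= buchstab_sum R x a b.
Proof.
move=> a0 ab b1 /andP[d0 d1] e0 /cvgrPdist_le cvg_d.
pose h := e / 2; have h0 : 0 < h by rewrite divr_gt0.
(* [prime_sum_lower] wants a nonnegative constant, while [d - h] may be negative. *)
pose d' := Num.max 0 (d - h).
have nearX : \forall X \near +oo, d' * X <= smooth_count R X (X `^ (a / (1 - a))).
  apply: filterS2 (nbhs_pinfty_gt (num_real 0)) (cvg_d _ h0) => X X0.
  rewrite /smooth_density ler_norml => /andP[_ +].
  rewrite lerBlDr addrC -lerBlDr ler_pdivlMr // => hd.
  rewrite /d'; case: (leP 0 (d - h)) => _; last by rewrite mul0r smooth_count_ge0.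
  exact: hd.
have b1' : 0 < 1 - b by lra.
have b0 : 0 < b by lra.
have := near_pinfty_div_ln_le R _ _ (ltW (divr_gt0 (ltr0n _ 10) b0)) h0.
apply: filterS3 (nbhs_pinfty_gt (num_real 1)) (near_pinfty_uniform_powR R _ _ b1' nearX) => x x1 hX.
rewrite -mulrA -invfM => hk.
have x0 : 0 < x by lra.
have lnx : 0 < ln x by rewrite ln_gt0.
have y1 : 1 < x `^ a by apply: powR_gt1.
have yz : x `^ a <= x `^ b by rewrite ler_powR // ltW.
have d'0 : 0 <= d' by rewrite le_max lexx.
have d'1 : d' <= 1 by rewrite ge_max ler01; lra.
have d'd : d - h <= d' by rewrite le_max lexx orbT.
apply: le_trans (prime_sum_lower R _ d' _ _ d'0 y1 yz _); last first.
  move=> p p_pr /andP[p_gt p_le].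
  have p0 : 0 < p%:R :> R by rewrite ltr0n prime_gt0.
  rewrite ler_pdivlMr // mulrAC -mulrA.
  apply: le_trans (hX _ (powR_quotient_ge_base R _ _ _ x0 p0 p_le)) _.
  by apply/le_smooth_count/powR_quotient_le => //; lra.
rewrite !ln_powR.
have -> : (b * ln x - a * ln x - 10) / (b * ln x) = (b - a) / b - 10 / (b * ln x).
  by field; rewrite !gt_eqF.
have s0 : 0 <= (b - a) / b by rewrite divr_ge0 //; lra.
have s1 : (b - a) / b <= 1 by rewrite ler_pdivrMr //; lra.
have k0 : 0 <= 10 / (b * ln x) by rewrite divr_ge0 // mulr_ge0 // ltW.
move: hk s0 s1 k0; set s := (b - a) / b; set k := 10 / _ => hk s0 s1 k0.
have e1 : (d - h) * s <= d' * s by rewrite ler_wpM2r.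
have e2 : d' * k <= k by rewrite ler_piMl.
have e3 : h * s <= h by rewrite ler_piMr // ltW.
have e4 : h + h = e by rewrite /h; lra.
clearbody d' h s k; lra.
Qed.

Lemma buchstab_sum_cat (R : realType) (x a b c : R) : 1 <= x -> a <= b -> b <= c ->
  buchstab_sum R x a c = buchstab_sum R x a b + buchstab_sum R x b c.
Proof. by move=> x1 ab bc; apply: prime_sum_cat; rewrite ler_powR. Qed.

Lemma buchstab_sum_ge0 (R : realType) (x a b : R) : 0 <= x -> 0 <= buchstab_sum R x a b.
Proof. by move=> x0; apply: sumr_ge0 => p _; rewrite divr_ge0 ?smooth_count_ge0. Qed.

(* The oscillation of the Buchstab sum at infinity is at most 2 E. *)
Definition osc_le (R : realType) (a E : R) : Prop :=
  exists L : R, forall e, 0 < e ->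
    \forall x \near +oo, `|buchstab_sum R x a 1 - L| <= E + e.

(** At [b = 1] the exponent [b / (1 - b)] has no meaning, so the last piece gets the trivial bound
    [smooth_count R (x / p) p <= x / p]. *)
Lemma osc_le_last (R : realType) (a : R) :
  0 < a -> a < 1 -> osc_le R a ((1 - a) / a).
Proof.
move=> a0 a1; exists 0 => e e0.
have := near_pinfty_div_ln_le R _ _ (ltW (divr_gt0 (ltr0n _ 10) a0)) e0.
apply: filterS2 (nbhs_pinfty_gt (num_real 1)) => x x1.
rewrite -mulrA -invfM subr0 => hk.
have x0 : 0 < x by lra.
have lnx : 0 < ln x by rewrite ln_gt0.
have y1 : 1 < x `^ a by apply: powR_gt1.
have yz : x `^ a <= x `^ 1 by rewrite ler_powR // ltW.
rewrite ger0_norm ?buchstab_sum_ge0 ?(ltW x0) //.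
apply: le_trans (prime_sum_upper R _ 1 _ _ ler01 y1 yz _) _.
  move=> p p_pr _; have p0 : 0 < p%:R :> R by rewrite ltr0n prime_gt0.
  rewrite ler_pdivrMr // mulrAC -mulrA mul1r.
  by rewrite smooth_count_le // divr_ge0 // ltW.
rewrite mul1r !ln_powR mul1r.
have -> : (ln x - a * ln x + 10) / (a * ln x) = (1 - a) / a + 10 / (a * ln x).
  by field; rewrite !gt_eqF.
by rewrite lerD2l.
Qed.

(** The piece from [a] to [b] is eventually caught, up to small errors, between [da (b - a) / b] and
    [db (b - a) / a]. The gap is added to the oscillation, the lower value to the centre [L]. *)
Lemma osc_le_step (R : realType) (a b da db E : R) :
  0 < a -> a <= b -> b < 1 -> 0 <= da <= 1 -> 0 <= db <= 1 ->
  smooth_density R (a / (1 - a)) x @[x --> +oo] --> da ->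
  smooth_density R (b / (1 - b)) x @[x --> +oo] --> db ->
  osc_le R b E -> osc_le R a (E + (b - a) * (db / a - da / b)).
Proof.
move=> a0 ab b1 da01 db01 cvg_a cvg_b [L hL].
exists (L + da * ((b - a) / b)) => e e0.
have e2 : 0 < e / 4 by rewrite divr_gt0.
have := hL _ e2.
have := buchstab_sum_lower R _ _ _ _ a0 ab b1 da01 e2 cvg_a.
have := buchstab_sum_upper R _ _ _ _ a0 ab b1 db01 e2 cvg_b.
have := nbhs_pinfty_gt (num_real (1 : R)).
move=> near1 near2 near3 near4.
apply: filterS2 (filterI near1 near2) (filterI near3 near4) => x [x1 up] [low].
rewrite !ler_norml => /andP[h1 h2].
rewrite (buchstab_sum_cat R x a b 1) ?(ltW x1) ?(ltW b1) //.
have -> : (b - a) * (db / a - da / b) = db * ((b - a) / a) - da * ((b - a) / b).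
  by field; rewrite !gt_eqF //; lra.
(* Up to [e / 2] the lower value does not exceed the upper one; the lower half of the absolute value
   needs this. *)
have := le_trans low up.
move: (buchstab_sum R x a b) (buchstab_sum R x b 1) (da * _) (db * _) up low h1 h2.
move=> S1 S2 s1 s2 ? ? ? ? ?; apply/andP; split; lra.
Qed.

Lemma osc_le_trans (R : realType) (a E E' : R) : E <= E' -> osc_le R a E -> osc_le R a E'.
Proof.
move=> EE' [L hL]; exists L => e e0; apply: filterS (hL e e0) => x /le_trans; apply.
by rewrite lerD2r.
Qed.

(** [[u, 1]] is cut into [m] pieces of length [h], treated from 1 downwards. By monotonicity of the
    limits [D] the gaps of the pieces telescope, leaving at most [3 h / u]. *)
Lemma osc_le_small (R : realType) (u : R) : 0 < u -> u < 1 ->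
  (forall v, u <= v -> v < 1 -> cvg (smooth_density R (v / (1 - v)) x @[x --> +oo])) ->
  forall e, 0 < e -> osc_le R u e.
Proof.
move=> u0 u1 hcvg e e0.
pose D v := lim (smooth_density R (v / (1 - v)) x @[x --> +oo]).
have D01 v : u <= v -> v < 1 -> 0 <= D v <= 1.
  move=> uv v1; apply/andP; split.
    apply: limr_ge; first exact: hcvg.
    apply: filterS (nbhs_pinfty_gt (num_real 0)) => x x0.
    by rewrite divr_ge0 ?smooth_count_ge0 // ltW.
  apply: limr_le; first exact: hcvg.
  apply: filterS (nbhs_pinfty_gt (num_real 0)) => x x0.
  by rewrite ler_pdivrMr // mul1r smooth_count_le // ltW.
have D_le v w : u <= v -> v <= w -> w < 1 -> D v <= D w.
  move=> uv vw w1; apply: ler_lim; [apply: hcvg; lra|apply: hcvg; lra|].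
  apply: filterS (nbhs_pinfty_gt (num_real 1)) => x x1.
  have x0 : 0 < x by lra.
  rewrite ler_wpM2r ?invr_ge0 ?(ltW x0) // le_smooth_count // ler_powR ?(ltW x1) //.
  rewrite ler_pdivrMr; last by lra.
  by rewrite mulrAC ler_pdivlMr; [nra|lra].
(* With [h = (1 - u) / m] this makes [3 h / u <= e]. *)
pose m := (Num.truncn (3 / (u * e))).+1.
have m0 : 0 < m%:R :> R by rewrite ltr0n.
have m_gt : 3 / (u * e) < m%:R by apply: truncnS_gt.
pose h := (1 - u) / m%:R.
have h0 : 0 < h by rewrite divr_gt0 // subr_gt0.
have mh : m%:R * h = 1 - u by rewrite /h mulrC divfK ?gt_eqF.
have hu : 3 * h / u <= e.
  rewrite ler_pdivrMr // -(ler_pM2l m0).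
  have -> : m%:R * (3 * h) = 3 * (m%:R * h) by ring.
  rewrite mh; move: m_gt; rewrite ltr_pdivrMr ?mulr_gt0 //.
  have -> : m%:R * (u * e) = m%:R * (e * u) by ring.
  by set t := m%:R * _; lra.
(* A potential for the telescoping: the gap [D b / a - D a / b] of a piece is at most
   [phi b - phi a]. The difference is [(D b - D a) (1/u - 1/a) + (1 - D a) (1/a - 1/b)], where both
   products are nonnegative. *)
pose phi v := D v / u - v^-1.
have v_itv (i : nat) : (i < m)%N -> u <= 1 - i.+1%:R * h < 1.
  move=> im; have : i.+1%:R * h <= m%:R * h by rewrite ler_pM2r // ler_nat.
  have : 0 < i.+1%:R * h by rewrite mulr_gt0.
  by rewrite mh => ? ?; apply/andP; split; lra.
have step (i : nat) : (i < m)%N -> osc_le R (1 - i.+1%:R * h)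
    (h / u + h * (phi (1 - h) - phi (1 - i.+1%:R * h))).
  elim: i => [|i IHi] im.
    rewrite mul1r subrr mulr0 addr0; have := v_itv _ im; rewrite mul1r => /andP[uh h1].
    have h1' : 0 < 1 - h by lra.
    apply: osc_le_trans (osc_le_last R (1 - h) h1' h1).
    by rewrite opprB addrC subrK ler_pM2l // lef_pV2 ?posrE.
  have /andP[ua a1] := v_itv _ im; have /andP[ub b1] := v_itv _ (ltnW im).
  have := IHi (ltnW im).
  have ba : 1 - i.+1%:R * h = 1 - i.+2%:R * h + h by rewrite -[i.+2%:R]natr1; ring.
  move: ua a1 ub b1 ba; set a := 1 - i.+2%:R * h; set b := 1 - i.+1%:R * h.
  move=> ua a1 ub b1 ba oscb.
  have a0 : 0 < a by lra.
  have b0 : 0 < b by lra.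
  have ab : a <= b by lra.
  have := osc_le_step R a b (D a) (D b) _ a0 ab b1 (D01 _ ua a1) (D01 _ ub b1)
    (hcvg _ ua a1) (hcvg _ ub b1) oscb.
  apply: osc_le_trans; rewrite -addrA lerD2l.
  have -> : b - a = h by lra.
  rewrite -mulrDr ler_pM2l // -subr_ge0 /phi.
  have -> : D (1 - h) / u - (1 - h)^-1 - (D a / u - a^-1) -
     (D (1 - h) / u - (1 - h)^-1 - (D b / u - b^-1) + (D b / a - D a / b)) =
     (D b - D a) * (u^-1 - a^-1) + (1 - D a) * (a^-1 - b^-1) by ring.
  have /andP[Da0 Da1] := D01 _ ua a1.
  rewrite addr_ge0 // mulr_ge0 ?subr_ge0 ?D_le ?lef_pV2 ?posrE //.
(* At index [m - 1] the left endpoint is [u], and [phi (1 - h) - phi u <= 2 / u] because [D] lies in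
   [0, 1]. *)
have m1 : (m.-1 < m)%N by [].
have := step _ m1; rewrite prednK // mh opprB addrC subrK.
apply: osc_le_trans; apply: le_trans hu.
have -> : 3 * h / u = h / u + h * (2 / u) by ring.
rewrite lerD2l ler_pM2l // /phi.
have /andP[uh h1] := v_itv _ (ltn0Sn _); rewrite mul1r in uh h1.
have /andP[_ Dh1] := D01 _ uh h1; have /andP[Du0 _] := D01 _ (lexx _) u1.
have h1' : 0 < 1 - h by lra.
rewrite -subr_ge0.
have -> : 2 / u - (D (1 - h) / u - (1 - h)^-1 - (D u / u - u^-1))
   = (1 - D (1 - h)) / u + (1 - h)^-1 + D u / u by ring.
by rewrite !addr_ge0 ?invr_ge0 ?divr_ge0 ?(ltW h1') ?(ltW u0) ?subr_ge0.
Qed.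

(** * Existence of the density *)

Lemma truncn_div_near1 (R : realType) (x : R) :
  0 < x -> `|1 - (Num.truncn x)%:R / x| <= x^-1.
Proof.
move=> x0; have /andP[le_x x_lt] := truncn_itv (ltW x0).
rewrite -[X in X - _](mulfV (lt0r_neq0 x0)) -mulrBl normrM [ `|x^-1| ]gtr0_norm ?invr_gt0 //.
rewrite ger0_norm ?subr_ge0 // ler_piMl ?invr_ge0 ?(ltW x0) //.
by rewrite lerBlDl ltW // natr1.
Qed.

Lemma smooth_density_buchstab (R : realType) (u x : R) : 0 < u -> u <= 1 -> 1 <= x ->
  smooth_density R u x = (Num.truncn x)%:R / x - buchstab_sum R x u 1.
Proof.
move=> u0 u1 x1; have x0 : 0 < x by lra.
have y1 : 1 <= x `^ u by rewrite -[leLHS](powRr0 x) ler_powR // ltW.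
have yx : x `^ u <= x `^ 1 by rewrite ler_powR.
rewrite /smooth_density /buchstab_sum.
have := buchstab R x _ _ (ltW x0) y1 yx.
rewrite powRr1 ?(ltW x0) // smooth_count_full ?(ltW x0) // => /eqP.
rewrite subr_eq addrC -subr_eq => /eqP <-; rewrite mulrBl; congr (_ - _).
by rewrite /prime_sum mulr_suml.
Qed.

Lemma near_pinfty_inv_le (R : realType) (e : R) : 0 < e -> \forall x \near +oo, x^-1 <= e.
Proof.
move=> e0; apply: filterS2 (nbhs_pinfty_gt (num_real 0)) (nbhs_pinfty_gt (num_real e^-1)) => x x0 ex.
by rewrite -[leRHS]invrK lef_pV2 ?posrE ?invr_gt0 // ltW.
Qed.

(** Since the Buchstab sum has arbitrarily small oscillation, the density at [u] eventually stays in
    a ball of radius [e] about [1 - L], which is the Cauchy criterion. *)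
Lemma cvg_smooth_density_step (R : realType) (u : R) : 0 < u -> u < 1 ->
  (forall v, u <= v -> v < 1 -> cvg (smooth_density R (v / (1 - v)) x @[x --> +oo])) ->
  cvg (smooth_density R u x @[x --> +oo]).
Proof.
move=> u0 u1 hcvg; apply: cauchy_cvg; apply: cauchy_exP => e e0.
have e4 : 0 < e / 4 by rewrite divr_gt0.
have [L hL] := osc_le_small R u u0 u1 hcvg _ e4.
exists (1 - L); rewrite /= /fmap /=.
have near1 := nbhs_pinfty_gt (num_real (1 : R)).
apply: filterS3 near1 (near_pinfty_inv_le R _ e4) (hL _ e4) => x x1 ix hS.
have x0 : 0 < x by lra.
rewrite /ball /= smooth_density_buchstab ?(ltW u1) ?(ltW x1) //.
have := truncn_div_near1 R x x0; move: hS; rewrite !ler_norml => /andP[? ?] /andP[? ?].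
by rewrite ltr_norml; apply/andP; split; lra.
Qed.

Lemma cvg_smooth_density_ge1 (R : realType) (u : R) :
  1 <= u -> cvg (smooth_density R u x @[x --> +oo]).
Proof.
move=> u1; apply/cvg_ex; exists 1; apply/cvgrPdist_le => e e0.
have near1 := nbhs_pinfty_gt (num_real (1 : R)).
apply: filterS2 near1 (near_pinfty_inv_le R _ e0) => x x1 ix.
have x0 : 0 < x by lra.
have := truncn_div_near1 R x x0; rewrite !ler_norml => /andP[_ h].
have up : smooth_density R u x <= 1 by rewrite ler_pdivrMr // mul1r smooth_count_le // ltW.
have low : (Num.truncn x)%:R / x <= smooth_density R u x.
  rewrite ler_wpM2r ?invr_ge0 ?(ltW x0) // -smooth_count_full ?(ltW x0) //.
  by rewrite le_smooth_count // -[leLHS](powRr1 (ltW x0)) ler_powR // ltW.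
apply/andP; split; lra.
Qed.

(** Induction on [k] for exponents at least [1 / (k + 1)]: if [1 / (k + 2) <= v <= w < 1] then
    [w / (1 - w) >= 1 / (k + 1)], so the densities required at [v] are known to converge. *)
Lemma cvg_smooth_density (R : realType) (u : R) :
  0 < u -> cvg (smooth_density R u x @[x --> +oo]).
Proof.
move=> u0.
suff H k : forall v : R, 1 <= v * k.+1%:R -> cvg (smooth_density R v x @[x --> +oo]).
  apply: (H (Num.truncn u^-1)).
  by rewrite mulrC -ler_pdivrMr // div1r ltW // truncnS_gt.
elim: k => [|k IHk] v hv; first by apply: cvg_smooth_density_ge1; rewrite mulr1 in hv.
have k0 : 0 < k.+2%:R :> R by [].
have v0 : 0 < v by rewrite -(pmulr_lgt0 _ k0); lra.
have [v1|v1] := leP 1 v; first exact: cvg_smooth_density_ge1.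
apply: cvg_smooth_density_step => // w vw w1; apply: IHk.
rewrite mulrAC ler_pdivlMr ?subr_gt0 // mul1r lerBlDr.
apply: (le_trans hv); rewrite -[k.+2%:R]natr1 mulrDr mulr1.
by rewrite lerD // ler_wpM2r.
Qed.

(** * Comparison of the two counts *)

Lemma count_upto_sub (R : realType) (P Q E : pred nat) (x : R) :
  0 <= x -> (forall n, (0 < n)%N -> n%:R <= x -> P n -> Q n || E n) ->
  (count_upto P x <= count_upto Q x + count_upto E x)%N.
Proof.
move=> x_ge0 PQE; rewrite /count_upto.
rewrite big_mkcond [X in (_ <= X + _)%N]big_mkcond [X in (_ <= _ + X)%N]big_mkcond.
rewrite -big_split /= big_nat_cond [leqRHS]big_nat_cond; apply: leq_sum => n.
rewrite andbT ltnS truncn_ge_nat // => /andP[n_gt0 n_le].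
by case: ifP => // /(PQE _ n_gt0 n_le) /orP[] ->; rewrite ?leq_addl ?leq_addr.
Qed.

Lemma count_upto_initial (R : realType) (x y : R) :
  0 <= y -> (count_upto (fun n => n%:R <= y) x)%:R <= y.
Proof.
move=> y_ge0; have /andP[+ _] := truncn_itv y_ge0; apply: le_trans.
rewrite ler_nat /count_upto.
under eq_bigl => n do rewrite -truncn_ge_nat //.
elim: (Num.truncn x) => [|N IHN]; first by rewrite big_geq.
rewrite big_mkcond big_nat_recr //= -big_mkcond; case: ifP => [N_lt|_]; last by rewrite addn0.
apply: leq_trans N_lt; rewrite addn1 ltnS.
apply: (@leq_trans (\sum_(1 <= n < N.+1) 1)).
  by rewrite big_mkcond; apply: leq_sum => n _; case: ifP.
by rewrite sum_nat_const_nat muln1 subn1.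
Qed.

(** Blocks of [H] consecutive integers cover the range, the last possibly overshooting [x]; each
    contains at most [Y] exceptions. *)
Lemma count_smooth_large_graham_t_blocks (R : realType) (H Y : nat) (x : R) :
  (0 < H)%N ->
  (count_upto (fun n => (max_pdiv n <= Y) && (H < graham_t n))%N x <=
   (Num.truncn x %/ H).+1 * Y)%N.
Proof.
move=> H_gt0; rewrite /count_upto; move: (Num.truncn x) => N.
set E := fun n => ((max_pdiv n <= Y) && (H < graham_t n))%N.
have blocks k : (\sum_(1 <= n < (k * H).+1 | E n) 1 <= k * Y)%N.
  elim: k => [|k IHk]; first by rewrite big_geq.
  rewrite (@big_cat_nat _ _ _ (k * H).+1) /=; [|lia|rewrite mulSn; lia].
  rewrite [leqRHS]mulSn addnC; apply: leq_add => //.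
  rewrite mulSn addnC; apply: count_smooth_large_graham_t => n _ /andP[-> t_gt].
  by split=> //; apply: ltnW.
apply: leq_trans (blocks _).
have N_le : (N <= (N %/ H).+1 * H)%N by apply/ltnW/ltn_ceil.
by rewrite [leqRHS](@big_cat_nat _ _ _ N.+1) //= leq_addr.
Qed.

(** Telescoping with [1 / (m + 1) ^ 2 <= 1 / m - 1 / (m + 1)]. *)
Lemma sum_inv_sq_le (R : realType) (a b : nat) :
  (0 < a)%N -> \sum_(a.+1 <= m < b.+1) (m%:R ^+ 2)^-1 <= a%:R^-1 :> R.
Proof.
move=> a_gt0; have a_pos : 0 < a%:R :> R by rewrite ltr0n.
have [ba|ab] := leqP b a; first by rewrite big_geq // invr_ge0 ltW.
suff : \sum_(a.+1 <= m < b.+1) (m%:R ^+ 2)^-1 <= a%:R^-1 - b%:R^-1 :> R.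
  by move=> /le_trans; apply; rewrite gerBl invr_ge0.
move/ltnW: ab; elim: b => [|b IHb] ab; first by lia.
have [ba|ab'] := ltnP b a.
  have -> : a = b.+1 by lia.
  by rewrite big_geq // subrr.
rewrite big_nat_recr //=; apply: le_trans (lerD (IHb ab') (lexx _)) _.
have b_pos : 0 < b%:R :> R by rewrite ltr0n; lia.
rewrite -addrA lerD2l -[b.+1%:R]natr1 -subr_ge0.
have -> : - (b%:R + 1)^-1 - (- b%:R^-1 + ((b%:R + 1) ^+ 2)^-1) =
    (b%:R * (b%:R + 1) ^+ 2)^-1 :> R.
  by field; rewrite !gt_eqF //; lra.
by rewrite invr_ge0 mulr_ge0 ?exprn_ge0 // ltW // ltr_wpDr.
Qed.

(** Each such [n] is a multiple of [m ^ 2] for some [m > W]; a union bound over all integers [m],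
    prime or not, leads to the sum of the [x / m ^ 2]. *)
Lemma count_sq_divisor_le (R : realType) (W : nat) (x : R) :
  (0 < W)%N -> 0 <= x ->
  (count_upto (fun n => (W < max_pdiv n) && (max_pdiv n ^ 2 %| n))%N x)%:R
    <= x / W%:R.
Proof.
move=> W_gt0 x_ge0; rewrite /count_upto; set N := Num.truncn x.
have N_le : N%:R <= x by have /andP[] := truncn_itv x_ge0.
apply: (@le_trans _ _ (\sum_(W.+1 <= m < N.+1) (N %/ m ^ 2)%:R)); last first.
  apply: (@le_trans _ _ (\sum_(W.+1 <= m < N.+1) x * (m%:R ^+ 2)^-1)); last first.
    by rewrite -mulr_sumr ler_wpM2l // sum_inv_sq_le.
  rewrite big_nat_cond [leRHS]big_nat_cond.
  apply: ler_sum => m /andP[/andP[m_gt _] _].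
  have m_pos : 0 < m%:R ^+ 2 :> R by rewrite exprn_gt0 // ltr0n; lia.
  rewrite ler_pdivlMr // -natrX -natrM (le_trans _ N_le) // ler_nat.
  exact: leq_trunc_div.
rewrite -natr_sum ler_nat.
apply: (@leq_trans (\sum_(1 <= n < N.+1) \sum_(W.+1 <= m < N.+1) (m ^ 2 %| n))); last first.
  rewrite exchange_big /= big_nat_cond [leqRHS]big_nat_cond.
  apply: leq_sum => m /andP[/andP[m_gt _] _].
  have m2_gt0 : (0 < m ^ 2)%N by rewrite expn_gt0; lia.
  have := sum_multiples predT (m ^ 2) N m2_gt0.
  rewrite sum_nat_const_nat muln1 subn1 /= => <-; rewrite [leqRHS]big_mkcond.
  by apply: leq_sum => n _; rewrite andbT; case: (_ %| _)%N.
rewrite big_mkcond big_nat_cond [leqRHS]big_nat_cond.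
apply: leq_sum => n /andP[/andP[n_gt0 n_le] _]; case: ifP => // /andP[W_lt sq_dvd].
have P_le : (max_pdiv n <= N)%N by apply: leq_trans (max_pdiv_leq n_gt0) _.
rewrite (bigD1_seq (max_pdiv n)) ?iota_uniq //=; last by rewrite mem_index_iota W_lt.
by rewrite sq_dvd.
Qed.

(** By Buchstab's identity with the trivial bound [x / p], the integers with largest prime factor in
    [(k x ^ c, x ^ c]] number at most [x (10 - ln k) / ln (k x ^ c)]. *)
Lemma near_smooth_count_rescale (R : realType) (c k e : R) :
  0 < c -> 0 < k -> k <= 1 -> 0 < e ->
  \forall x \near +oo,
    smooth_count R x (x `^ c) <= smooth_count R x (k * x `^ c) + e * x.
Proof.
move=> c0 k0 k1 e0.
have near1 := nbhs_pinfty_gt (num_real (1 : R)).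
(* The threshold is equivalent to [ln (k x ^ c) > (10 - ln k) / e]. *)
apply: filterS2 near1 (near_pinfty_ln_gt R (((10 - ln k) / e - ln k) / c)) => x x1.
have x0 : 0 < x by lra.
have z0 : 0 < x `^ c by rewrite powR_gt0.
have y0 : 0 < k * x `^ c by rewrite mulr_gt0.
have lnk : ln k <= 0 by rewrite ln_le0.
rewrite ltr_pdivrMr // [ln x * c]mulrC ltrBlDl -ln_powR -lnM // => hln.
have lny : 0 < ln (k * x `^ c).
  by apply: le_lt_trans hln; rewrite divr_ge0 ?ltW //; lra.
have y1 : 1 < k * x `^ c.
  by rewrite ltNge; apply/negP => /ln_le0; rewrite leNgt lny.
have yz : k * x `^ c <= x `^ c by rewrite ler_piMl // ltW.
rewrite addrC -lerBlDr buchstab ?(ltW x0) ?(ltW y1) // [e * x]mulrC.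
apply: le_trans (prime_sum_upper R _ x _ _ (ltW x0) y1 yz _) _.
  by move=> p p_pr _; rewrite smooth_count_le // divr_ge0 // ltW.
rewrite ler_wpM2l ?(ltW x0) // ler_pdivrMr //.
move: hln; rewrite ltr_pdivrMr // [_ * e]mulrC => /ltW; apply: le_trans.
by rewrite lnM //; lra.
Qed.

Lemma cvg_count_upto_near (R : realType) (c d : R) (P : pred nat) :
  smooth_density R c x @[x --> +oo] --> d ->
  (forall e, 0 < e -> \forall x \near +oo,
     (count_upto P x)%:R <= smooth_count R x (x `^ c) + e * x) ->
  (forall e, 0 < e -> \forall x \near +oo,
     smooth_count R x (x `^ c) <= (count_upto P x)%:R + e * x) ->
  (count_upto P x)%:R / x @[x --> +oo] --> d.
Proof.
move=> /cvgrPdist_le cvg_d up low; apply/cvgrPdist_le => e e0.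
have e2 : 0 < e / 2 by rewrite divr_gt0.
have near0 := nbhs_pinfty_gt (num_real (0 : R)).
apply: filterS2 (filterI near0 (cvg_d _ e2)) (filterI (up _ e2) (low _ e2)).
move=> x [x0]; rewrite /smooth_density !ler_norml => /andP[h1 h2] [h3 h4].
have : (count_upto P x)%:R / x <= smooth_count R x (x `^ c) / x + e / 2.
  by rewrite ler_pdivrMr // mulrDl divfK // gt_eqF.
have : smooth_count R x (x `^ c) / x <= (count_upto P x)%:R / x + e / 2.
  by rewrite ler_pdivrMr // mulrDl divfK // gt_eqF.
move: (_ / x) (_ / x) h1 h2 => s t h1 h2 h5 h6; apply/andP; split; lra.
Qed.

(** If [n] is counted on the left but [max_pdiv n > x ^ c], then [graham_t n <= n ^ c <= x ^ c <
    max_pdiv n], so the square of [max_pdiv n] divides [n]. At most [x / W] integers do this. *)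
Lemma near_count_graham_t_le (R : realType) (c e : R) : 0 < c -> 0 < e ->
  \forall x \near +oo,
    (count_upto (fun n => (graham_t n)%:R <= n%:R `^ c) x)%:R
      <= smooth_count R x (x `^ c) + e * x.
Proof.
move=> c0 e0; have near1 := nbhs_pinfty_gt (num_real (1 : R)).
(* The summand 1 pays for the truncation, so that [W > 1 / e]. *)
apply: filterS2 near1 (near_pinfty_powR_gt R c (e^-1 + 1) c0) => x x1 xc.
have x0 : 0 < x by lra.
pose W := Num.truncn (x `^ c).
have W_gt : e^-1 < W%:R.
  by have := truncnS_gt (x `^ c); rewrite -/W -natr1; lra.
have W_pos : 0 < W%:R :> R by apply: lt_trans W_gt; rewrite invr_gt0.
have W_gt0 : (0 < W)%N by rewrite -(ltr0n R).
apply: le_trans (_ : smooth_count R x (x `^ c) + x / W%:R <= _); last first.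
  by rewrite lerD2l mulrC ler_pM2r // -[e]invrK lef_pV2 ?posrE ?invr_gt0 // ltW.
apply: le_trans (lerD (lexx _) (count_sq_divisor_le R W x W_gt0 (ltW x0))).
rewrite /smooth_count -natrD ler_nat; apply: count_upto_sub; first exact: ltW.
move=> n n_gt0 n_le t_le; have [//|/= P_gt] := leP (max_pdiv n)%:R (x `^ c).
have nc : n%:R `^ c <= x `^ c by rewrite ge0_ler_powR ?nnegrE ?(ltW c0) ?(ltW x0).
have t_lt : (graham_t n < max_pdiv n)%N by rewrite -(ltr_nat R); lra.
have /orP[/eqP n1|->] := graham_t_lt_max_pdiv n n_gt0 t_lt.
  by move: P_gt; rewrite n1 (_ : max_pdiv 1 = 1%N) // => ?; have := powR_gt1 R x c x1 c0; lra.
by rewrite andbT truncn_lt_nat ?powR_ge0.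
Qed.

(** With [Z = (q x) ^ c] the smoothness level is lowered to [q Z]. An integer counted there is at
    most [q x], or satisfies [graham_t n <= H <= Z <= n ^ c], or is an exception in a block of
    length [H], the integer part of [Z]. *)
Lemma near_smooth_count_le_graham_t (R : realType) (c e : R) :
  0 < c -> c <= 1 -> 0 < e ->
  \forall x \near +oo, smooth_count R x (x `^ c)
      <= (count_upto (fun n => (graham_t n)%:R <= n%:R `^ c) x)%:R + e * x.
Proof.
(* Five errors of size [q x]: one from lowering the level, one from [n <= q x], three from the
   blocks. *)
move=> c0 c1 e0; pose q := Num.min e 1 / 5.
have q0 : 0 < q by rewrite divr_gt0 // lt_min e0 ltr01.
have q1 : q <= 1 by rewrite ler_pdivrMr // ge_min; apply/orP; right; lra.
have qe : 5 * q <= e by rewrite mulrC divfK ?pnatr_eq0 // ge_min lexx.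
have qc0 : 0 < q `^ c by rewrite powR_gt0.
have qc1 : q `^ c <= 1.
  by rewrite -(congr1 (fun f => f c) (@powR1 R)) ge0_ler_powR ?nnegrE ?(ltW c0) ?(ltW q0).
have k1 : q * q `^ c <= 1 by rewrite mulr_ile1 // ltW.
have near1 := nbhs_pinfty_gt (num_real (q^-1 : R)).
apply: filterS2 near1 (near_smooth_count_rescale R c _ q c0 (mulr_gt0 q0 qc0) k1 q0) => x xq.
have x0 : 0 < x by apply: lt_trans xq; rewrite invr_gt0.
have qx1 : 1 <= q * x by rewrite mulrC -ler_pdivrMr // div1r ltW.
have qx0 : 0 <= q * x by lra.
have qxx : q * x <= x by rewrite ler_piMl // ltW.
rewrite -mulrA -powRM ?(ltW q0) ?(ltW x0) //.
set Z := (q * x) `^ c.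
have Z1 : 1 <= Z.
  by rewrite /Z -(congr1 (fun f => f c) (@powR1 R)) ge0_ler_powR ?nnegrE ?(ltW c0).
have Z0 : 0 <= Z by lra.
(* Here [c <= 1] enters; it bounds the contribution [q Z] of the extra block by [q x]. *)
have Zx : Z <= x by apply: le_trans qxx; exact: ler1_powR.
pose H := Num.truncn Z; pose Y := Num.truncn (q * Z).
have H_gt0 : (0 < H)%N by rewrite truncn_gt0.
have H_le : H%:R <= Z by have /andP[] := truncn_itv Z0.
(* As [H >= 1], rounding at most halves [Z]; hence a block has at most [Y <= 2 q H] exceptions. *)
have Z_le : Z <= 2 * H%:R.
  have := truncnS_gt Z; rewrite -/H -natr1; have : 1 <= H%:R :> R by rewrite ler1n.
  lra.
have qZ0 : 0 <= q * Z by rewrite mulr_ge0 // ltW.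
have Y_le : Y%:R <= q * Z by have /andP[] := truncn_itv qZ0.
pose A n := (graham_t n)%:R <= (n%:R : R) `^ c.
pose I n := (n%:R : R) <= q * x.
pose X n := ((max_pdiv n <= Y) && (H < graham_t n))%N.
rewrite -/A => rescale.
have split1 : smooth_count R x (q * Z) <=
    (count_upto A x)%:R + ((count_upto I x)%:R + (count_upto X x)%:R).
  rewrite -!natrD ler_nat.
  have x_ge0 := ltW x0.
  apply: leq_trans (count_upto_sub _ _ A (fun n => I n || X n) _ x_ge0 _) _; last first.
    rewrite leq_add2l; exact: count_upto_sub.
  move=> n n_gt0 n_le P_le; rewrite /I /X; have [|n_gt /=] := leP n%:R (q * x).
    by rewrite orbT.
  rewrite truncn_ge_nat // P_le /=; have [t_le|] := leqP (graham_t n) H; last by rewrite orbT.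
  rewrite orbF /A; apply: (@le_trans _ _ H%:R); first by rewrite ler_nat.
  apply: (le_trans H_le); rewrite ge0_ler_powR ?nnegrE ?(ltW c0) //.
  exact: ltW.
have I_le : (count_upto I x)%:R <= q * x by exact: count_upto_initial.
have X_le : (count_upto X x)%:R <= 3 * (q * x).
  have := count_smooth_large_graham_t_blocks R H Y x H_gt0.
  rewrite -(ler_nat R) => /le_trans; apply; rewrite mulSn natrD natrM.
  set k := (_ %/ H)%N.
  have kH : k%:R * H%:R <= x.
    have /andP[+ _] := truncn_itv (ltW x0); apply: le_trans.
    by rewrite -natrM ler_nat leq_trunc_div.
  have YH : Y%:R <= q * (2 * H%:R) by apply: (le_trans Y_le); rewrite ler_pM2l.
  have : k%:R * Y%:R <= q * (2 * (k%:R * H%:R)).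
    by apply: le_trans (ler_wpM2l (ler0n _ _) YH) _; rewrite le_eqVlt; apply/orP; left; apply/eqP; ring.
  have : q * (2 * (k%:R * H%:R)) <= q * (2 * x) by rewrite ler_pM2l // ler_pM2l.
  have : q * Z <= q * x by rewrite ler_pM2l.
  have -> : q * (2 * x) = 2 * (q * x) by ring.
  lra.
have ex : 5 * (q * x) <= e * x by rewrite mulrA ler_pM2r.
lra.
Qed.

(** Once the level is lowered to [(q x) ^ c], an integer [n > q x] still counted has
    [max_pdiv n <= (q x) ^ c <= n ^ c]. The lowering and the integers up to [q x] cost [q x]
    each. *)
Lemma near_smooth_count_le_max_pdiv (R : realType) (c e : R) : 0 < c -> 0 < e ->
  \forall x \near +oo, smooth_count R x (x `^ c)
      <= (count_upto (fun n => (max_pdiv n)%:R <= n%:R `^ c) x)%:R + e * x.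
Proof.
move=> c0 e0; pose q := Num.min e 1 / 2.
have q0 : 0 < q by rewrite divr_gt0 // lt_min e0 ltr01.
have q1 : q <= 1 by rewrite ler_pdivrMr // ge_min; apply/orP; right; lra.
have qe : 2 * q <= e by rewrite mulrC divfK ?pnatr_eq0 // ge_min lexx.
have qc0 : 0 < q `^ c by rewrite powR_gt0.
have qc1 : q `^ c <= 1.
  by rewrite -(congr1 (fun f => f c) (@powR1 R)) ge0_ler_powR ?nnegrE ?(ltW c0) ?(ltW q0).
have near0 := nbhs_pinfty_gt (num_real (0 : R)).
apply: filterS2 near0 (near_smooth_count_rescale R c _ q c0 qc0 qc1 q0) => x x0.
rewrite -powRM ?(ltW q0) ?(ltW x0) //; set Z := (q * x) `^ c.
have qx0 : 0 <= q * x by rewrite mulr_ge0 ?ltW.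
pose I n := (n%:R : R) <= q * x.
have split1 : smooth_count R x Z <=
    (count_upto (fun n => (max_pdiv n)%:R <= (n%:R : R) `^ c) x)%:R + (count_upto I x)%:R.
  rewrite -natrD ler_nat; apply: count_upto_sub; first exact: ltW.
  move=> n n_gt0 n_le P_le; rewrite /I; have [|n_gt /=] := leP n%:R (q * x).
    by rewrite orbT.
  by rewrite orbF (le_trans P_le) // ge0_ler_powR ?nnegrE ?(ltW c0) // ltW.
have I_le : (count_upto I x)%:R <= q * x by exact: count_upto_initial.
have ex : 2 * (q * x) <= e * x by rewrite mulrA ler_pM2r.
lra.
Qed.

Lemma near_count_max_pdiv_le (R : realType) (c e : R) : 0 < c -> 0 < e ->
  \forall x \near +oo,
    (count_upto (fun n => (max_pdiv n)%:R <= n%:R `^ c) x)%:R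
      <= smooth_count R x (x `^ c) + e * x.
Proof.
move=> c0 e0; apply: filterS (nbhs_pinfty_gt (num_real (0 : R))) => x x0.
apply: (@le_trans _ _ (smooth_count R x (x `^ c))); last first.
  by rewrite lerDl mulr_ge0 // ltW.
rewrite ler_nat -[leqRHS]addn0.
have -> : 0%N = count_upto pred0 x by rewrite /count_upto big_pred0.
apply: count_upto_sub; first exact: (ltW x0).
move=> n n_gt0 n_le P_le; rewrite orbF (le_trans P_le) //.
by rewrite ge0_ler_powR ?nnegrE ?ler0n ?(ltW c0) ?(ltW x0).
Qed.

Theorem theorem1p1 (R : realType) (c : R) (c_gt0 : 0 < c) (c_le1 : c <= 1) :
  exists l : R,
    ((count_upto (fun n => (graham_t n)%:R <= n%:R `^ c) x)%:R / x
       @[x --> +oo%R] --> l) /\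
    ((count_upto (fun n => (max_pdiv n)%:R <= n%:R `^ c) x)%:R / x
       @[x --> +oo%R] --> l).
Proof.
have /cvg_ex[l cvg_l] := cvg_smooth_density R c c_gt0.
exists l; split; apply: (cvg_count_upto_near R c l _ cvg_l) => e e_gt0.
- exact: near_count_graham_t_le.
- exact: near_smooth_count_le_graham_t.
- exact: near_count_max_pdiv_le.
- exact: near_smooth_count_le_max_pdiv.
Qed.
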